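(* Let $p$ be a positive integer. For $n \geq 0$, let $a(n,p)$ be the total number of parts congruent to $0 \pmod{p}$, counted over all partitions of $n$ in which every part appears at most $p-1$ times, and let $o_{p}(n)$ be the number of partitions of $n$ in which the set of (distinct values of) parts congruent to $0 \pmod{p}$ has exactly one element (that part may appear with any multiplicity; parts not divisible by $p$ are unrestricted). Then for all $n \geq 0$, $$p \mid a(n,p) - o_{p}(n).$$ *)

(* Defs.v *)
From HB Require Import structures.
From mathcomp Require Import all_boot all_order all_algebra.

Set Implicit Arguments.
Unset Strict Implicit.
Unset Printing Implicit Defensive.

Definition is_intpart (n : nat) (s : seq nat) : bool :=
  [&& sorted geq s, 0 \notin s & sumn s == n].

Record intpart (n : nat) : Type :=
  IntPart { parts :> seq nat; _ : is_intpart n parts }.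

HB.instance Definition _ n := [isSub for @parts n].
HB.instance Definition _ n := [Countable of intpart n by <:].

(* A partition of [n] has at most [n] parts, each at most [n]; this encoding
   serves only to equip [intpart n] with its finite type structure. *)
Definition intpart_encode n (l : intpart n) : n.-bseq 'I_n.+1 :=
  insub_bseq n [seq inord k | k <- parts l].

Definition intpart_decode n (b : n.-bseq 'I_n.+1) : option (intpart n) :=
  insub [seq val i | i <- b].

Lemma intpart_encodeK n : pcancel (@intpart_encode n) (@intpart_decode n).
Proof.
move=> l; have /and3P[_ nz_l /eqP sum_l] := valP l.
have le_l k : k \in parts l -> k <= n.
  move=> kl; rewrite -[leqRHS]sum_l.
  by rewrite (perm_sumn (perm_to_rem kl)) leq_addr.
have size_l : size (parts l) <= n.
  suff le_sum s : 0 \notin s -> size s <= sumn s.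
    by rewrite (leq_trans (le_sum _ nz_l)) ?sum_l.
  elim: s => //= k s IHs.
  rewrite inE negb_or eq_sym -lt0n => /andP[k_gt0 /IHs le_s].
  by rewrite -add1n leq_add.
rewrite /intpart_decode /intpart_encode /insub_bseq.
rewrite val_insubd size_map size_l -map_comp.
rewrite (_ : map _ _ = parts l) ?valK //.
by apply: map_id_in => k kl /=; rewrite inordK // ltnS le_l.
Qed.

HB.instance Definition _ n : isFinite (intpart n) :=
  PCanIsFinite (@intpart_encodeK n).

Definition a_count (n p : nat) : nat :=
  \sum_(l : intpart n | all (fun k => count_mem k l <= p - 1) l)
    count (fun k => p %| k) l.

Definition o_count (p n : nat) : nat :=
  #|[set l : intpart n | size (undup [seq k <- l | p %| k]) == 1]|.

(* Main.v *)
(**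
Write [b_i = \sum_(j < p) x^(i j)] and [R = \prod_i b_i]. Marking the number of
copies of each part [m] divisible by [p], the generating function of [a(n, p)]
is [\sum_(m | p %| m) (\sum_(j < p) j x^(m j)) * \prod_(i != m) b_i]. Modulo
[p], [(1 - y) * \sum_(j < p) j y^j = y * \sum_(j < p) y^j], so this is
[R * \sum_(m | p %| m) x^m / (1 - x^m)]. By Glaisher's identity
[R = \prod_(i | ~~ (p %| i)) 1 / (1 - x^i)], and the result is the generating
function of [o_p(n)]. The computation takes place in ['Z_p[X] / X^(n+1)], where
[x] is nilpotent and [1 - x^i] is invertible.
*)
Require Import Defs.
From mathcomp Require Import all_boot all_order all_algebra.
Import GRing.Theory.

Set Implicit Arguments.
Unset Strict Implicit.
Unset Printing Implicit Defensive.

(** * Geometric sums at a nilpotent element, and Glaisher's identity *)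

Section TruncatedSeries.

Local Open Scope ring_scope.

Variables (A : comNzRingType) (n : nat).
Implicit Types x y : A.

Lemma expr_nilp y k : y ^+ n.+1 = 0 -> (n < k)%N -> y ^+ k = 0.
Proof. by move=> y0 ltnk; rewrite -(subnK ltnk) exprD y0 mulr0. Qed.

Lemma geom_sumM y k : (1 - y) * (\sum_(j < k) y ^+ j) = 1 - y ^+ k.
Proof. by rewrite -[RHS]opprB subrX1 -mulNr opprB. Qed.

(** Widened to [n.+1 + p] terms, the two sums agree: beyond [n] the powers of [y] vanish, up to [n]
    the factor [j < p] does the cutting. Series of length [p] thus get the range [j < n.+1] that
    bounds multiplicities in partitions of [n]. *)
Lemma sum_nilp_trunc y (c : nat -> nat) p : y ^+ n.+1 = 0 ->
  \sum_(j < n.+1) y ^+ j *+ ((j < p) * c j) = \sum_(j < p) y ^+ j *+ c j.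
Proof.
move=> y0.
rewrite (big_ord_widen _ (fun j => y ^+ j *+ ((j < p) * c j))
  (leq_addr p n.+1)).
rewrite (big_ord_widen _ (fun j => y ^+ j *+ c j) (leq_addl n.+1 p)).
rewrite big_mkcond [RHS]big_mkcond; apply: eq_bigr => j _.
case: ltnP => [_|ltnj]; first by case: ifP => _; rewrite ?mul1n ?mul0n.
by rewrite (expr_nilp y0) // mul0rn if_same.
Qed.

(** Kept over an arbitrary ring so that induction on [p] applies; the error term [y ^+ p *+ p] dies
    once [p%:R = 0]. *)
Lemma weighted_geom_sumM y p :
  (1 - y) * (\sum_(j < p) y ^+ j *+ j) =
    y * (\sum_(j < p) y ^+ j) - y ^+ p *+ p.
Proof.
elim: p => [|p IH]; first by rewrite !big_ord0 !mulr0 subr0.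
rewrite !big_ord_recr /= !mulrDr IH mulrBl mul1r mulrnAr -exprS.
by rewrite [y ^+ p.+1 *+ p.+1]mulrS opprD !addrA addrK subrK.
Qed.

Lemma weighted_geom_sum y p : y ^+ n.+1 = 0 -> p%:R = 0 :> A ->
  \sum_(j < p) y ^+ j *+ j =
    (\sum_(j < n.+1) y ^+ j *+ (0 < j)) * (\sum_(j < p) y ^+ j).
Proof.
move=> y0 p0; set g := \sum_(j < n.+1) y ^+ j.
(* Nilpotency makes [g] an inverse of [1 - y], so the preceding identity can be divided by
   [1 - y]. *)
have gK : (1 - y) * g = 1 by rewrite geom_sumM y0 subr0.
have -> : \sum_(j < n.+1) y ^+ j *+ (0 < j) = y * g.
  rewrite big_ord_recl mulr0n add0r /g big_ord_recr /= mulrDr -exprS y0 addr0.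
  by rewrite big_distrr; apply: eq_bigr => j _ /=; rewrite mulr1n -exprS.
rewrite -[LHS]mul1r -gK mulrAC weighted_geom_sumM -mulr_natr p0 mulr0 subr0.
by rewrite mulrAC.
Qed.

Lemma prod_multiples m (F : nat -> A) p : (0 < p)%N ->
  \prod_(i < m | (p %| i.+1)%N) F i.+1 = \prod_(i < m %/ p) F (p * i.+1)%N.
Proof.
move=> p_gt0; elim: m => [|m IH]; first by rewrite div0n !big_ord0.
rewrite big_mkcond big_ord_recr -big_mkcond /= IH divnS //.
case: ifP => [dvd|_]; last by rewrite mulr1.
rewrite add1n big_ord_recr /=; congr (_ * F _).
by rewrite -[LHS](divnK dvd) divnS // dvd mulnC.
Qed.

(** Multiplying the left factors by [1 - x ^+ i.+1] turns them into [1 - x ^+ (i.+1 * p)]; these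
    cancel the inverses [g i] with [p %| i.+1], leaving the others. *)
Lemma glaisher x p : x ^+ n.+1 = 0 -> (0 < p)%N ->
  \prod_(i < n) (\sum_(j < p) (x ^+ i.+1) ^+ j) =
  \prod_(i < n | ~~ (p %| i.+1)%N) (\sum_(j < n.+1) (x ^+ i.+1) ^+ j).
Proof.
move=> x0 p_gt0; pose g i := \sum_(j < n.+1) (x ^+ i.+1) ^+ j.
have gK i : (1 - x ^+ i.+1) * g i = 1.
  by rewrite geom_sumM -exprM (expr_nilp x0) ?subr0 // mulSn leq_addr.
have prodK (P : pred nat) :
    (\prod_(i < n | P i) (1 - x ^+ i.+1)) * (\prod_(i < n | P i) g i) = 1.
  by rewrite -big_split big1 //= => i _; rewrite gK.
(* Factors with [p * i.+1 > n] equal 1, so only the multiples of [p] up to [n] remain. *)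
have dvd_prod : \prod_(i < n) (1 - (x ^+ i.+1) ^+ p) =
                \prod_(i < n | (p %| i.+1)%N) (1 - x ^+ i.+1).
  rewrite (prod_multiples n (fun k => 1 - x ^+ k) p_gt0).
  rewrite (big_ord_widen _ (fun i => 1 - x ^+ (p * i.+1)) (leq_div n p)).
  rewrite [RHS]big_mkcond; apply: eq_bigr => i _.
  rewrite -exprM mulnC leq_divRL // [(i.+1 * p)%N]mulnC; case: leqP => // lt.
  by rewrite (expr_nilp x0) ?subr0.
rewrite -[LHS]mul1r -[X in X * _](prodK predT) mulrAC -big_split /=.
under eq_bigr do rewrite geom_sumM.
rewrite dvd_prod [X in _ * X](bigID (fun i : 'I_n => p %| i.+1)%N) /=.
by rewrite mulrA (prodK (fun i => p %| i.+1)%N) mul1r.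
Qed.

(** The equality holds for each [m] separately. On the left, the marked factor splits off [E] and
    leaves an ordinary geometric sum, which completes the product in [glaisher]. *)
Lemma regular_parts_series x p : x ^+ n.+1 = 0 -> (0 < p)%N -> p%:R = 0 :> A ->
  \sum_(m < n | (p %| m.+1)%N) \prod_(i < n)
    (\sum_(j < n.+1) (x ^+ i.+1) ^+ j *+
       ((j < p) * (if i == m then j : nat else 1))) =
  \sum_(m < n | (p %| m.+1)%N) \prod_(i < n)
    (\sum_(j < n.+1) (x ^+ i.+1) ^+ j *+
       (if (p %| i.+1)%N then
          (if i == m then 0 < j else j == 0 :> nat)%N
        else true)).
Proof.
move=> x0 hp p0; apply: eq_bigr => m dvd_m.
have xi0 (i : 'I_n) : (x ^+ i.+1) ^+ n.+1 = 0.
  by rewrite -exprM (expr_nilp x0) // mulSn leq_addr.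
pose E := \sum_(j < n.+1) (x ^+ m.+1) ^+ j *+ (0 < j)%N.
transitivity (E * \prod_(i < n) (\sum_(j < p) (x ^+ i.+1) ^+ j)).
  rewrite (bigD1 m) //= [in RHS](bigD1 m) //= mulrA eqxx; congr (_ * _).
    by rewrite (sum_nilp_trunc id) ?weighted_geom_sum.
  apply: eq_bigr => i /negPf ->.
  by rewrite (sum_nilp_trunc (fun=> 1%N)).
rewrite glaisher // [RHS](bigD1 m) //= dvd_m eqxx; congr (_ * _).
rewrite [RHS]big_mkcond [LHS]big_mkcond; apply: eq_bigr => i _.
have [->|ne_im] := eqVneq i m; first by rewrite dvd_m.
(* An unmarked multiple of [p] may not occur: only [j = 0] survives, and its factor is 1. *)
case: (boolP (p %| i.+1)%N) => //= _.
by rewrite big_ord_recl expr0 big1 ?addr0.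
Qed.

End TruncatedSeries.

(** * Partitions as multiplicity functions, and weighted counts as coefficients *)

Section Partitions.

Variable n : nat.
Implicit Type l : intpart n.

Lemma intpart_mem l k : k \in parts l -> 0 < k <= n.
Proof.
have /and3P[_ nz_l /eqP sum_l] := valP l => kl.
rewrite lt0n; apply/andP; split; first by apply: contraNneq nz_l => <-.
by rewrite -[leqRHS]sum_l (perm_sumn (perm_to_rem kl)) leq_addr.
Qed.

Lemma sum_intpart l (E : nat -> nat) :
  \sum_(k <- parts l) E k = \sum_(i < n) E i.+1 * count_mem i.+1 (parts l).
Proof.
transitivity (\sum_(k <- parts l) \sum_(i < n) E i.+1 * (k == i.+1)).
  rewrite [LHS]big_seq [RHS]big_seq; apply: eq_bigr => k /intpart_mem/andP[].
  case: k => // k _ ltkn; rewrite (bigD1 (Ordinal ltkn)) //= eqxx muln1.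
  rewrite big1 ?addn0 // => i ne_i; rewrite eqSS.
  case: eqP => [ki|]; last by rewrite muln0.
  by case/eqP: ne_i; apply: val_inj.
rewrite exchange_big /=; apply: eq_bigr => i _.
by rewrite -big_distrr -sum1_count [in RHS]big_mkcond; congr (_ * _).
Qed.

Lemma count_intpart_le l i : count_mem i.+1 (parts l) <= n.
Proof.
have /and3P[_ _ /eqP sum_l] := valP l.
have [il|/count_memPn->//] := boolP (i.+1 \in parts l).
have /andP[_ ltin] := intpart_mem il.
rewrite -[leqRHS]sum_l sumnE sum_intpart (bigD1 (Ordinal ltin)) //=.
by rewrite (leq_trans _ (leq_addr _ _)) // leq_pmull.
Qed.

(** Index [i] stands for the part [i.+1]. By [count_intpart_le] the [inord] never falls back to its
    default, and finite functions are what expanding a product of sums ranges over. *)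
Definition mult_fun l : {ffun 'I_n -> 'I_n.+1} :=
  [ffun i : 'I_n => inord (count_mem i.+1 (parts l))].

Lemma mult_funE l (i : 'I_n) : mult_fun l i = count_mem i.+1 (parts l) :> nat.
Proof. by rewrite ffunE inordK // ltnS count_intpart_le. Qed.

Lemma mult_fun_inj : injective mult_fun.
Proof.
move=> l1 l2 eq_l; apply: val_inj => /=.
have /and3P[s1 _ _] := valP l1; have /and3P[s2 _ _] := valP l2.
have geq_trans : transitive geq by apply: rev_trans; exact: leq_trans.
have geq_anti : antisymmetric geq by move=> x y; rewrite andbC; exact: anti_leq.
apply: (sorted_eq geq_trans geq_anti s1 s2).
apply/allP => k /= k12; apply/eqP.
have /andP[k_gt0 lekn] : 0 < k <= n.
  by move: k12; rewrite mem_cat => /orP[]/intpart_mem.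
case: k k_gt0 lekn {k12} => // k _ ltkn.
by rewrite -!(mult_funE _ (Ordinal ltkn)) eq_l.
Qed.

Lemma mult_fun_image :
  [set mult_fun l | l : intpart n] =
  [set f : {ffun 'I_n -> 'I_n.+1} | \sum_(i < n) i.+1 * f i == n].
Proof.
apply/setP => f; rewrite inE; apply/imsetP/eqP => [[l _ ->]|sum_f].
  under eq_bigr do rewrite mult_funE.
  by rewrite -(sum_intpart l id) -sumnE; have /and3P[_ _ /eqP] := valP l.
(* The preimage of [f] is [s], with [f i] copies of [i.+1], sorted decreasingly. *)
pose s := flatten [seq nseq (f i) i.+1 | i : 'I_n].
have count_s (i : 'I_n) : count_mem i.+1 s = f i.
  rewrite count_flatten -map_comp sumnE big_map big_enum /= (bigD1 i) //=.
  rewrite count_nseq /= eqxx mul1n big1 ?addn0 // => j ne_ji.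
  by rewrite count_nseq /= eqSS val_eqE (negPf ne_ji).
have s_part : is_intpart n (sort geq s).
  rewrite /is_intpart sort_sorted; last by move=> x y; exact: leq_total.
  rewrite mem_sort (perm_sumn (permEl (perm_sort _ _))) /=; apply/andP; split.
    by apply/negP => /flattenP[_ /mapP[i _ ->]]; rewrite mem_nseq andbC.
  rewrite sumn_flatten -map_comp sumnE big_map big_enum /=.
  by under eq_bigr do rewrite sumn_nseq; apply/eqP.
exists (IntPart s_part) => //; apply/ffunP => i; apply: val_inj.
by rewrite /= mult_funE (permP (permEl (perm_sort _ _))) count_s.
Qed.

(** Expanding the product, a choice [f] of exponents gives a monomial of degree
    [\sum_(i < n) i.+1 * f i]. Degree [n] selects exactly the image of [mult_fun]. *)
Lemma coef_weighted_partitions (R : comNzRingType) (F : nat -> nat -> nat) :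
  ((\sum_(l : intpart n) \prod_(i < n) F i (count_mem i.+1 (parts l)))%:R =
   (\prod_(i < n) \sum_(j < n.+1) ('X ^+ i.+1) ^+ j *+ F i j)`_n :> R)%R.
Proof.
rewrite bigA_distr_bigA coef_sum /=.
have coef_term (f : {ffun 'I_n -> 'I_n.+1}) :
    ((\prod_(i < n) (('X ^+ i.+1) ^+ f i *+ F i (f i)))`_n =
     if \sum_(i < n) i.+1 * f i == n then (\prod_(i < n) F i (f i))%:R
     else 0 :> R)%R.
  under eq_bigr do rewrite -exprM.
  by rewrite prodrMn prodrXr coefMn coefXn eq_sym; case: eqP; rewrite ?mul0rn.
under [RHS]eq_bigr do rewrite coef_term.
rewrite -big_mkcond -[in RHS]natr_sum; congr _%:R%R.
rewrite (eq_bigl (fun f => f \in [set mult_fun l | l : intpart n])) /=;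
  last by move=> f; rewrite mult_fun_image [RHS]inE.
rewrite big_imset /=; last by move=> l1 l2 _ _; exact: mult_fun_inj.
by apply: eq_bigr => l _; apply: eq_bigr => i _; rewrite mult_funE.
Qed.

Lemma prod_bool (b : pred 'I_n) : \prod_(i < n) b i = [forall i, b i] :> nat.
Proof.
case: forallP => [all_b|/forallP].
  by rewrite big1 // => i _; rewrite all_b.
by rewrite negb_forall => /existsP[i /negPf bi]; rewrite (bigD1 i) //= bi.
Qed.

(** Double counting: the parts divisible by [p] are grouped by their value [m.+1]. The product is
    the multiplicity of [m.+1] times the indicator of the bound on all multiplicities. *)
Lemma a_count_prod p : 0 < p ->
  a_count n p = \sum_(m < n | p %| m.+1) \sum_(l : intpart n) \prod_(i < n)
    ((count_mem i.+1 (parts l) < p) *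
       (if i == m then count_mem i.+1 (parts l) else 1)).
Proof.
move=> p_gt0; rewrite exchange_big /a_count big_mkcond /=.
apply: eq_bigr => l _.
under eq_bigr => m _.
  rewrite big_split /= (prod_bool (fun i => count_mem i.+1 l < p)).
  rewrite -big_mkcond big_pred1_eq; over.
rewrite -big_distrr /=.
have -> : all (fun k => count_mem k l <= p - 1) l =
          [forall i : 'I_n, count_mem i.+1 l < p].
  apply/allP/forallP => /= [lt_l i|lt_l k kl].
    have [il|/count_memPn->//] := boolP (i.+1 \in parts l).
    by rewrite -(subnK p_gt0) addn1 ltnS lt_l.
  have /andP[k_gt0 lekn] := intpart_mem kl.
  case: k k_gt0 lekn {kl} => // k _ ltkn.
  have := lt_l (Ordinal ltkn).
  by rewrite -[in X in X -> _](subnK p_gt0) addn1 ltnS.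
case: ifP => _; last by rewrite mul0n.
rewrite mul1n -sum1_count big_mkcond (sum_intpart l (fun k => p %| k : nat)).
rewrite [RHS]big_mkcond; apply: eq_bigr => i _.
by case: ifP => _; rewrite ?mul1n ?mul0n.
Qed.

Lemma o_count_prod p :
  o_count p n = \sum_(m < n | p %| m.+1) \sum_(l : intpart n) \prod_(i < n)
    (if p %| i.+1 then
       if i == m then 0 < count_mem i.+1 (parts l)
       else count_mem i.+1 (parts l) == 0
     else true).
Proof.
rewrite exchange_big /o_count cardsE -sum1_card big_mkcond /=.
apply: eq_bigr => l _.
set u := undup [seq k <- parts l | p %| k].
transitivity (size u == 1 : nat); first by [].
have mem_u k : (k \in u) = (p %| k) && (k \in parts l).
  by rewrite mem_undup mem_filter.
have : uniq u by exact: undup_uniq.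
move: u mem_u => u mem_u uniq_u.
(* A partition counted by [o_count] contributes for exactly one [m], given by its only part value
   divisible by [p]. *)
transitivity (\sum_(m < n | p %| m.+1) (u == [:: m.+1])).
  case: u mem_u {uniq_u} => [|k [|k2 v]] mem_u.
  - by rewrite big1.
  - have /andP[dvd_k kl] : (p %| k) && (k \in parts l) by rewrite -mem_u inE.
    have /andP[k_gt0 lekn] := intpart_mem kl.
    case: k k_gt0 lekn dvd_k {mem_u kl} => // k _ ltkn dvd_k.
    rewrite (bigD1 (Ordinal ltkn)) //= eqxx big1 // => m /andP[_ ne_m].
    rewrite eqseq_cons andbT eqSS eq_sym -[k]/(val (Ordinal ltkn)) val_eqE.
    by rewrite (negPf ne_m).
  - by rewrite big1 // => m _; rewrite eqseq_cons andbF.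
apply: eq_bigr => m dvd_m; rewrite prod_bool; congr nat_of_bool.
apply/eqP/forallP => [u_m i|u_m].
  case: ifP => // dvd_i; move: (mem_u i.+1).
  rewrite dvd_i u_m inE eqSS val_eqE /=.
  case: eqP => [_|_] /esym; rewrite -has_pred1 has_count // => /negbT.
  by rewrite -eqn0Ngt.
have := u_m m; rewrite dvd_m eqxx -has_count has_pred1 => ml.
apply: perm_small_eq => //; apply: uniq_perm => //.
move=> k; rewrite mem_u inE; apply/andP/eqP => [[dvd_k kl]|-> //].
have /andP[k_gt0 lekn] := intpart_mem kl.
case: k k_gt0 lekn kl dvd_k => // k _ ltkn kl dvd_k.
have := u_m (Ordinal ltkn); rewrite dvd_k /= -val_eqE /=.
by case: eqP => [->//|_]; rewrite eqn0Ngt -has_count has_pred1 kl.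
Qed.

End Partitions.

(** * Comparison of the two coefficients modulo [p] *)

Theorem theorem3 (p : nat) (hp : 0 < p) (n : nat) :
  (p%:Z %| ((a_count n p)%:Z - (o_count p n)%:Z)%R)%Z.
Proof.
(* The case [p = 1] is set apart because ['Z_p] is the ring of integers modulo [p] only for
   [p > 1]. *)
have [->|p_neq1] := eqVneq p 1; first by rewrite dvd1z.
have p_gt1 : 1 < p by rewrite ltn_neqAle eq_sym p_neq1.
rewrite -eqz_mod_dvd; apply/eqP; rewrite !modz_nat; congr Posz.
rewrite -!(val_Zp_nat p_gt1); congr nat_of_ord.
rewrite a_count_prod // o_count_prod !natr_sum.
under eq_bigr => m _.
  rewrite (coef_weighted_partitions n _
    (fun i j => (j < p) * (if i == m then j else 1))).
  over.
under [RHS]eq_bigr => m _.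
  rewrite (coef_weighted_partitions n _ (fun i j =>
    if p %| i.+1 then if i == m then 0 < j else j == 0 else true)).
  over.
rewrite -!coef_sum.
set P := (\sum_(m < n | _) _)%R; set Q := (\sum_(m < n | _) _)%R.
pose h : {poly 'Z_p} := ('X^(n.+1))%R.
have hE : mk_monic h = h by rewrite mk_monic_Xn.
pose x : {poly %/ h} := in_qpoly h 'X.
have x0 : (x ^+ n.+1 = 0)%R.
  rewrite -rmorphXn; apply: val_inj.
  by rewrite /= hE Pdiv.RingMonic.rmodpp ?monicXn.
have p0 : (p%:R = 0 :> {poly %/ h})%R.
  by rewrite -(rmorph_nat (in_qpoly h)) -polyC_natr pchar_Zp // rmorph0.
(* Reduction modulo ['X^(n.+1)] preserves the coefficient of degree [n], so equality in the quotient
   suffices. *)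
suff eqPQ : in_qpoly h P = in_qpoly h Q.
  have := congr1 (fun q : {poly %/ h} => (val q)`_n)%R eqPQ.
  by rewrite /= hE -!Pdiv.RingMonic.take_poly_rmodp !coef_take_poly ltnSn.
have image_series (F : nat -> nat -> nat -> nat) :
    (in_qpoly h (\sum_(m < n | (p %| m.+1)%N) \prod_(i < n)
       (\sum_(j < n.+1) ('X ^+ i.+1) ^+ j *+ F m i j)) =
     \sum_(m < n | (p %| m.+1)%N) \prod_(i < n)
       (\sum_(j < n.+1) (x ^+ i.+1) ^+ j *+ F m i j))%R.
  rewrite rmorph_sum; apply: eq_bigr => m _.
  rewrite rmorph_prod; apply: eq_bigr => i _.
  by rewrite rmorph_sum; apply: eq_bigr => j _; rewrite rmorphMn !rmorphXn.
rewrite (image_series (fun m i j => (j < p) * (if i == m then j else 1))).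
rewrite (image_series (fun m i j =>
  if p %| i.+1 then if i == m then 0 < j else j == 0 else true)).
exact: regular_parts_series x0 hp p0.
Qed.
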